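(* Let $f:\mathbb{R}^{2n}\to\mathbb{R}^{2n}$ be smooth of the form $f=J^{-1}\nabla H$ with $H:\mathbb{R}^{2n}\to\mathbb{R}$ smooth, let $x\in\mathbb{R}^{2n}$, $A=Df(x)$, and let $U=Q_k$ be a matrix whose columns form an orthonormal basis of the Krylov subspace $K_k(A,f(x))$. Put $U^\dagger=U^T$, $F=U^\dagger AU$, let $h\in\mathbb{R}$, and consider the local system $\xi'(t)=g(\xi(t))$ with $g(\xi)=U^\dagger f(x+U\xi)$. Then applying each of the following three exponential integrators to the local system and lifting by $x_+=x+U\xi_+$ is equivalent to replacing, in the same integrator for $x'=f(x)$, every product $\varphi(\tau A)w$ (with $\varphi$ the exponential or $\phi$, and $\tau\in\{h,2h\}$) by its Krylov approximation $U\varphi(\tau F)U^\dagger w$: (i) Exponential Euler: with $\xi_+=h\,\phi(h\,Dg(0))\,g(0)$ one has $x+U\xi_+=x+h\,U\phi(hF)U^\dagger f(x)$. (ii) Explicit exponential midpoint rule: for $x_-\in\mathbb{R}^{2n}$, with $\xi_-=U^\dagger(x_--x)$ and $\xi_+=e^{h\,Dg(0)}\xi_-+2h\,\phi(h\,Dg(0))\,g(0)$, one has $x+U\xi_+=x+Ue^{hF}U^\dagger(x_--x)+2h\,U\phi(hF)U^\dagger f(x)$. (iii) Implicit exponential midpoint rule: for $\xi,\xi_+\in\mathbb{R}^{d}$ ($d$ the number of columns of $U$) and $\hat x=x+U\xi$, $x_+=x+U\xi_+$, the pair $(\hat x,x_+)$ satisfies $$0=Ue^{hF}U^\dagger(x-\hat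 x)+h\,U\phi(hF)U^\dagger f(\hat x),\qquad x_+=\hat x+Ue^{2hF}U^\dagger(x-\hat x)+2h\,U\phi(2hF)U^\dagger f(\hat x)$$ if and only if $(\xi,\xi_+)$ satisfies $$0=-e^{hF}\xi+h\,\phi(hF)\,U^\dagger f(x+U\xi),\qquad \xi_+=\xi-e^{2hF}\xi+2h\,\phi(2hF)\,U^\dagger f(x+U\xi).$$
   Context: $J=\begin{bmatrix}0&I_n\\-I_n&0\end{bmatrix}$. The Krylov subspace is $K_k(A,v)=\operatorname{span}\{v,Av,\dots,A^{k-1}v\}$. The entire function $\phi$ is $\phi(z)=\int_0^1 e^{tz}\,dt=z^{-1}(e^z-1)$ (with $\phi(0)=1$), applied to square matrices through its power series. For $x'=f(x)$ with $A=Df(x)$ the three integrators are: exponential Euler $x_+=x+h\phi(hA)f(x)$; explicit exponential midpoint rule $x_+=x+e^{hA}(x_--x)+2h\phi(hA)f(x)$; implicit exponential midpoint rule $0=e^{hA}(x-\hat x)+h\phi(hA)f(\hat x)$, $x_+=\hat x+e^{2hA}(x-\hat x)+2h\phi(2hA)f(\hat x)$. The second displayed system in (iii) is the implicit exponential midpoint rule for the local system, started at $\xi=0$, with linear part $F$. *)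

(* Defs.v *)
From HB Require Import structures.
From mathcomp Require Import all_boot all_order all_algebra.
From mathcomp Require Import all_classical all_reals all_analysis.

Set Implicit Arguments.
Unset Strict Implicit.
Unset Printing Implicit Defensive.

Import Order.TTheory GRing.Theory Num.Theory.
Import numFieldNormedType.Exports.

Local Open Scope classical_set_scope.
Local Open Scope ring_scope.

(* Vectors are columns, so the Jacobian matrix acts on the left; the library's
   [jacobian] is for maps between row vectors and is the transpose of this. *)
Definition Dmx (R : realType) (m p : nat) (f : 'cV[R]_m -> 'cV[R]_p)
    (x : 'cV[R]_m) : 'M[R]_(p, m) :=
  \matrix_(i, j) ('d f x (delta_mx j 0)) i 0.

Definition grad (R : realType) (m : nat) (H : 'cV[R]_m -> R^o)
    (x : 'cV[R]_m) : 'cV[R]_m :=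
  \col_i 'D_(delta_mx i 0) H x.

Fixpoint Ck (R : realType) (V W : normedModType R) (k : nat) (f : V -> W) :
    Prop :=
  if k is k'.+1 then
    (forall x, differentiable f x) /\ forall v, Ck k' (fun x => 'D_v f x)
  else continuous f.

Definition smooth (R : realType) (V W : normedModType R) (f : V -> W) : Prop :=
  forall k, Ck k f.

Definition Jmx (R : realType) (n : nat) : 'M[R]_(n + n) :=
  block_mx 0 1%:M (- 1%:M) 0.

Definition Krylov (R : realType) (m k : nat) (A : 'M[R]_m) (v : 'cV[R]_m) :
    {vspace 'cV[R]_m} :=
  <<[seq A ^+ i *m v | i <- iota 0 k]>>%VS.

Definition orthonormal_basis (R : realType) (m d : nat) (U : 'M[R]_(m, d))
    (K : {vspace 'cV[R]_m}) : Prop :=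
  U^T *m U = 1%:M /\ basis_of K [seq col j U | j : 'I_d].

Definition phi (R : realType) (z : R) : R :=
  (\int[lebesgue_measure]_(t in `[0, 1]) expR (t * z))%R.

(* Coefficients of the power series of exp and phi; see [cvg_phi] for the
   latter. *)
Definition exp_coef (R : realType) (k : nat) : R := (k`!%:R)^-1.
Definition phi_coef (R : realType) (k : nat) : R := ((k.+1)`!%:R)^-1.

Lemma phiE (R : realType) (z : R) :
  phi z = if z == 0 then 1 else z^-1 * (expR z - 1).
Proof.
case: eqVneq => [->|z0].
  rewrite /phi; under eq_Rintegral do rewrite mulr0 expR0.
  by rewrite Rintegral_cst//= lebesgue_measure_itv/= lte_fin ltr01 sube0 mul1r.
have dF (t : R) : is_derive t 1 (fun t => z^-1 * expR (t * z)) (expR (t * z)).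
  apply: trigger_derive => /=.
  by rewrite scaler0 add0r [z%:A]mulr1 [LHS]mulrCA mulVf// mulr1.
have cf (g dg : R -> R) (dG : forall t : R, is_derive t (1 : R) g (dg t)) :
    continuous g.
  by move=> t; apply/differentiable_continuous/derivable1_diffP; case: (dG t).
rewrite /phi /Rintegral
  (@continuous_FTC2 _ _ (fun t => z^-1 * expR (t * z))) ?ltr01//=.
- by rewrite mul1r mul0r expR0 mulrBr.
- apply: continuous_subspaceT => t.
  by apply: continuous_comp; [exact: mulrr_continuous|exact: continuous_expR].
- split; first by move=> t _; case: (dF t).
  + by apply: cvg_at_right_filter; exact: (cf _ _ dF).
  + by apply: cvg_at_left_filter; exact: (cf _ _ dF).
- by move=> t _; rewrite derive1E; case: (dF t).
Qed.

Lemma cvg_phi (R : realType) (z : R) :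
  pseries (@phi_coef R) z @ \oo --> phi z.
Proof.
rewrite phiE; have [->|z0] := eqVneq.
  rewrite -(cvg_shiftn 1) /=; apply: cvg_near_cst; near=> n.
  rewrite /pseries /series/= addn1 big_nat_recl//= big1 => [|i _].
    by rewrite /phi_coef expr0 addr0 mulr1 invr1.
  by rewrite expr0n mulr0.
have -> : pseries (@phi_coef R) z =
    (fun n => z^-1 * (series (exp_coeff z) n.+1 - 1)).
  apply/funext => n; rewrite /pseries /series/= big_nat_recl//=.
  rewrite /exp_coeff/= expr0 fact0 divr1 addrC addKr mulr_sumr.
  by apply: eq_bigr => i _; rewrite exprS mulrA mulrA mulVf// mul1r mulrC.
apply: cvgMl_tmp; apply: cvgB; last exact: cvg_cst.
rewrite [X in X @ _ --> _](_ : _ = [sequence series (exp_coeff z) (n + 1)%N]_n);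
  last by apply/funext => n; rewrite /= addn1.
rewrite (cvg_shiftn 1); exact: is_cvg_series_exp_coeff.
Unshelve. all: by end_near. Qed.

(* The value at M of the power series with coefficients c, as a limit in the
   normed space of matrices. *)
Definition mx_pseries (R : realType) (d : nat) (c : nat -> R) (M : 'M[R]_d) :
    'M[R]_d :=
  limn (series (fun k => c k *: M ^+ k : 'M[R]_d)).

Definition expmx (R : realType) (d : nat) (M : 'M[R]_d) : 'M[R]_d :=
  mx_pseries (@exp_coef R) M.
Definition phimx (R : realType) (d : nat) (M : 'M[R]_d) : 'M[R]_d :=
  mx_pseries (@phi_coef R) M.

(* The integrators are parametrized by the operation P used to evaluate their
   products: P c tau w stands for varphi(tau A) w, where c is the coefficient
   sequence of the power series of varphi. *)
Definition exact_prod (R : realType) (m : nat) (A : 'M[R]_m)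
    (c : nat -> R) (tau : R) (w : 'cV[R]_m) : 'cV[R]_m :=
  mx_pseries c (tau *: A) *m w.

Definition krylov_prod (R : realType) (m d : nat) (U : 'M[R]_(m, d))
    (F : 'M[R]_d) (c : nat -> R) (tau : R) (w : 'cV[R]_m) : 'cV[R]_m :=
  U *m mx_pseries c (tau *: F) *m U^T *m w.

Definition exp_euler (R : realType) (m : nat)
    (P : (nat -> R) -> R -> 'cV[R]_m -> 'cV[R]_m)
    (h : R) (f : 'cV[R]_m -> 'cV[R]_m) (x xp : 'cV[R]_m) : Prop :=
  xp = x + h *: P (@phi_coef R) h (f x).

Definition explicit_exp_midpoint (R : realType) (m : nat)
    (P : (nat -> R) -> R -> 'cV[R]_m -> 'cV[R]_m)
    (h : R) (f : 'cV[R]_m -> 'cV[R]_m) (xm x xp : 'cV[R]_m) : Prop :=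
  xp = x + P (@exp_coef R) h (xm - x) + (2 * h) *: P (@phi_coef R) h (f x).

Definition implicit_exp_midpoint (R : realType) (m : nat)
    (P : (nat -> R) -> R -> 'cV[R]_m -> 'cV[R]_m)
    (h : R) (f : 'cV[R]_m -> 'cV[R]_m) (x xhat xp : 'cV[R]_m) : Prop :=
  0 = P (@exp_coef R) h (x - xhat) + h *: P (@phi_coef R) h (f xhat) /\
  xp = xhat + P (@exp_coef R) (2 * h) (x - xhat)
       + (2 * h) *: P (@phi_coef R) (2 * h) (f xhat).

(* Main.v *)
Require Import Defs.
From HB Require Import structures.
From mathcomp Require Import all_boot all_order all_algebra.
From mathcomp Require Import all_classical all_reals all_analysis.

Import Order.TTheory GRing.Theory Num.Theory.
Import numFieldNormedType.Exports.

Local Open Scope classical_set_scope.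
Local Open Scope ring_scope.

(** The chain rule along the affine embedding [xi] -> [x + U *m xi] gives [Dmx g 0 = F], and clearly
    [g 0 = U^T *m f x], so the local integrators use the same matrix functions of [F] as the Krylov
    approximations ([Dmx_galerkin]). Every Krylov product begins with [U], and since [U^T *m U = 1],
    [U^T] sends a displacement [U *m u] back to [u]. Hence each lifted equation reads [0 = U *m u]
    or [x + U *m u = x + U *m v], and injectivity of [U] ([mulmx_lift_inj]) turns it into the local
    equation, and back. *)

Lemma mulmx_cV_continuous (R : realType) (m p : nat) (B : 'M[R]_(p, m)) :
  continuous (fun v : 'cV[R]_m => B *m v).
Proof.
have -> : (fun v : 'cV[R]_m => B *m v) =
    (fun v => \sum_(j < m) v j 0 *: col j B).
  apply/funext => v; apply/colP => i; rewrite mxE summxE; apply: eq_bigr => j _.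
  by rewrite !mxE mulrC.
apply: continuous_big => [v|j _ v]; first exact: add_continuous.
apply: (@continuous_comp _ _ _ (fun w : 'cV[R]_m => w j 0)
  (fun c => c *: col j B)); first exact: coord_continuous.
exact: scalel_continuous.
Qed.

(** A continuous linear map is its own differential; this supplies both linear factors, [U] and [W],
    of the chain rule below. *)
Lemma is_diff_mulmx_cV (R : realType) (m p : nat) (B : 'M[R]_(p, m))
    (v : 'cV[R]_m) : is_diff v (fun w : 'cV[R]_m => B *m w) (fun w => B *m w).
Proof.
have cB : continuous (mulmx B : 'cV[R]_m -> 'cV[R]_p).
  exact: mulmx_cV_continuous.
apply: DiffDef; first exact: linear_differentiable.
exact: diff_lin.
Qed.

Lemma diff_Dmx (R : realType) (m p : nat) (f : 'cV[R]_m -> 'cV[R]_p)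
    (x v : 'cV[R]_m) : 'd f x v = Dmx f x *m v.
Proof.
have -> : v = \sum_(j < m) v j 0 *: delta_mx j 0.
  rewrite {1}[v]matrix_sum_delta; apply: eq_bigr => j _.
  by rewrite big_ord1.
rewrite linear_sum mulmx_sumr; apply: eq_bigr => j _.
rewrite linearZ -scalemxAr; congr (_ *: _).
by apply/colP => i; rewrite -colE !mxE.
Qed.

(** Chain rule for [W] after [f] after the affine map [a], whose linear part is [U] and which sends
    0 to [x]. *)
Lemma Dmx_galerkin (R : realType) (m d : nat) (f : 'cV[R]_m -> 'cV[R]_m)
    (x : 'cV[R]_m) (U : 'M[R]_(m, d)) (W : 'M[R]_(d, m)) :
  differentiable f x ->
  Dmx (fun xi : 'cV[R]_d => W *m f (x + U *m xi)) 0 = W *m Dmx f x *m U.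
Proof.
move=> df; set a := fun xi : 'cV[R]_d => x + U *m xi.
have a0 : a 0 = x by rewrite /a mulmx0 addr0.
have da : is_diff (0 : 'cV[R]_d) a (fun w => U *m w).
  apply: is_diff_eq; last exact: add0r.
  by apply: is_diffD; exact: is_diff_mulmx_cV.
have dfa : is_diff (a 0) f ('d f x).
  by rewrite a0; exact: differentiableP.
have dg := is_diff_comp (is_diff_comp da dfa) (is_diff_mulmx_cV R _ _ W _).
apply/matrixP => i j; rewrite mxE.
(* Only the underlying functions are equated; at the basis vector [delta_mx j 0] the composite
   differential then yields column [j] of the product. *)
have -> : 'd (fun xi : 'cV[R]_d => W *m f (x + U *m xi)) 0 = _ :> (_ -> _) :=
  diff_val (is_diff_def := dg).
by rewrite /= diff_Dmx !mulmxA -colE mxE.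
Qed.

Lemma mulmx_lift_inj (R : realType) (m d : nat) (U : 'M[R]_(m, d)) :
  U^T *m U = 1%:M -> injective (mulmx U : 'cV[R]_d -> 'cV[R]_m).
Proof. by move=> UU u v /(congr1 (mulmx U^T)); rewrite !mulmxA UU !mul1mx. Qed.

Theorem mainTheorem4 (R : realType) (n k d : nat)
    (H : 'cV[R]_(n + n) -> R^o) (f : 'cV[R]_(n + n) -> 'cV[R]_(n + n))
    (x : 'cV[R]_(n + n)) (U : 'M[R]_(n + n, d)) (h : R)
    (H_smooth : smooth H) (f_smooth : smooth f)
    (f_ham : forall y, f y = invmx (Jmx R n) *m grad H y)
    (U_basis : orthonormal_basis U (Krylov k (Dmx f x) (f x))) :
  let A := Dmx f x in
  let F := U^T *m A *m U in
  let g := fun xi : 'cV[R]_d => U^T *m f (x + U *m xi) in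
  (* integrating the local system and lifting amounts to replacing the
     products by their Krylov approximations *)
  [/\ forall xip : 'cV[R]_d,
        exp_euler (exact_prod (Dmx g 0)) h g 0 xip <->
        exp_euler (krylov_prod U F) h f x (x + U *m xip),
      forall (xm : 'cV[R]_(n + n)) (xip : 'cV[R]_d),
        explicit_exp_midpoint (exact_prod (Dmx g 0)) h g
          (U^T *m (xm - x)) 0 xip <->
        explicit_exp_midpoint (krylov_prod U F) h f xm x (x + U *m xip)
    & forall xi xip : 'cV[R]_d,
        implicit_exp_midpoint (exact_prod (Dmx g 0)) h g 0 xi xip <->
        implicit_exp_midpoint (krylov_prod U F) h f x
          (x + U *m xi) (x + U *m xip)] /\
  (* the same, written out *)
  [/\ (let xip := h *: (phimx (h *: Dmx g 0) *m g 0) in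
       x + U *m xip = x + h *: (U *m phimx (h *: F) *m U^T *m f x)),
      (forall xm : 'cV[R]_(n + n),
       let xim := U^T *m (xm - x) in
       let xip := expmx (h *: Dmx g 0) *m xim
                  + (2 * h) *: (phimx (h *: Dmx g 0) *m g 0) in
       x + U *m xip =
         x + U *m expmx (h *: F) *m U^T *m (xm - x)
         + (2 * h) *: (U *m phimx (h *: F) *m U^T *m f x))
    & (forall xi xip : 'cV[R]_d,
       let xhat := x + U *m xi in
       let xp := x + U *m xip in
       (0 = U *m expmx (h *: F) *m U^T *m (x - xhat)
            + h *: (U *m phimx (h *: F) *m U^T *m f xhat) /\
        xp = xhat + U *m expmx ((2 * h) *: F) *m U^T *m (x - xhat)
             + (2 * h) *: (U *m phimx ((2 * h) *: F) *m U^T *m f xhat))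
       <->
       (0 = - (expmx (h *: F) *m xi)
            + h *: (phimx (h *: F) *m (U^T *m f (x + U *m xi))) /\
        xip = xi - expmx ((2 * h) *: F) *m xi
              + (2 * h) *: (phimx ((2 * h) *: F)
                            *m (U^T *m f (x + U *m xi)))))].
Proof.
case: U_basis => UU _ A F g.
have dg : Dmx g 0 = F.
  (* The [Ck 1] instance of smoothness contains differentiability at every point. *)
  by apply: Dmx_galerkin; case: (f_smooth 1).
have g0 : g 0 = U^T *m f x by rewrite /g mulmx0 addr0.
have Ui := mulmx_lift_inj _ _ _ U UU.
have UTK (u : 'cV[R]_d) : U^T *m (U *m u) = u by rewrite mulmxA UU mul1mx.
have lift_eq (u v : 'cV[R]_d) : x + U *m u = x + U *m v <-> u = v.
  by split=> [/addrI/Ui|->].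
have dx (u : 'cV[R]_d) : x - (x + U *m u) = U *m (- u).
  by rewrite opprD addNKr mulmxN.
have lift0 (u : 'cV[R]_d) : 0 = U *m u <-> 0 = u.
  by split=> [|<-]; rewrite ?mulmx0// => e; apply: Ui; rewrite mulmx0.
(* Stated for arbitrary matrices in place of the exponential and [phimx] values, so that it serves
   both the integrator form and the written-out form of the implicit rule. *)
have implicitE (E P E2 P2 : 'M[R]_d) (xi xip : 'cV[R]_d) :
  (0 = U *m E *m U^T *m (x - (x + U *m xi)) +
       h *: (U *m P *m U^T *m f (x + U *m xi)) /\
   x + U *m xip = x + U *m xi + U *m E2 *m U^T *m (x - (x + U *m xi)) +
       (2 * h) *: (U *m P2 *m U^T *m f (x + U *m xi))) <->
  (0 = - (E *m xi) + h *: (P *m g xi) /\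
   xip = xi - E2 *m xi + (2 * h) *: (P2 *m g xi)).
  (* Since [x - xhat = U *m (- xi)], the factor [U^T] recovers [- xi]; then [U] is pulled out of
     every sum and cancelled. *)
  rewrite dx -!mulmxA !UTK !mulmxN -/(g xi) !scalemxAr -!mulmxN.
  by rewrite -!addrA -!mulmxDr lift0 lift_eq.
rewrite /exp_euler /explicit_exp_midpoint /implicit_exp_midpoint
  /exact_prod /krylov_prod /phimx /expmx dg g0.
split; split.
- by move=> xip; rewrite add0r -!mulmxA [_ *: (U *m _)]scalemxAr lift_eq.
- move=> xm xip.
  rewrite add0r subr0 -!mulmxA [_ *: (U *m _)]scalemxAr -addrA -mulmxDr.
  by rewrite lift_eq.
(* The local system starts at 0, so its displacement [0 - xi] produces the term [- (E *m xi)]. *)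
- by move=> xi xip; rewrite implicitE !sub0r !mulmxN.
- by rewrite /= -!mulmxA [_ *: (U *m _)]scalemxAr.
- by move=> xm /=; rewrite -!mulmxA [_ *: (U *m _)]scalemxAr mulmxDr addrA.
- by move=> xi xip; exact: implicitE.
Qed.
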